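(* Let $\mathcal F$ be a class of Kripke frames that is closed under attaching descending $\omega$-chains: for every $\langle W_0,R_0\rangle\in\mathcal F$ and every $\mathsf w\in W_0$, the frame $\langle W,R\rangle$ belongs to $\mathcal F$, where $W=W_0\cup\mathbb N$ is a disjoint union with $\mathbb N=\{1,2,3,\dots\}$ and $$xRy\iff (x,y\in W_0\text{ and }xR_0y)\ \text{or}\ (x\in\mathbb N\text{ and }y=\mathsf w)\ \text{or}\ (x\in\mathbb N,\ y\in W_0\text{ and }\mathsf wR_0y)\ \text{or}\ (x,y\in\mathbb N\text{ and }x>y).$$ Let $L$ be the normal modal logic that is sound and complete with respect to $\mathcal F$, and let $L^+$ be the closure of $L\cup\{\Box\alpha\to\alpha\mid\alpha\in\mathsf{Fml}\}$ under modus ponens. Then $L^+$ is sound and complete with respect to each of the following four conditions; that is, for every formula $\varphi$, $\varphi\in L^+$ is equivalent to each of: \begin{itemize} \item[C1$^{\mathcal F}$.] There is a finite set $\Sigma$ of formulas such that $\varphi$ is true at any $\Sigma$-reflexive world in any $\mathcal F$-model. \item[C2$^{\mathcal F}$.] For any $\mathcal F$-model, there is a finite set $\Sigma$ of formulas such that $\varphi$ is true at any $\Sigma$-reflexive world of that model. \item[C3$^{\mathcal F}$.] For any $\mathcal F$-model $\langle W,R,V\rangle$ and any infinite sequence $w_1,w_2,w_3,\dots$ in $W$ such that $w_nRw_m$ for all $n>m$, there is $i$ such that $\varphi$ is true at $w_j$ for all $j\ge i$. \item[C4$^{\mathcal F}$.] For any $\mathcal F$-model $\langle W,R,V\rangle$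 and any infinite sequence $w_1,w_2,w_3,\dots$ in $W$ such that $w_nRw_m$ for all $n>m$, there is $i$ such that $\varphi$ is true at $w_i$. \end{itemize}
   Context: Formulas are built from propositional variables, the constant $\bot$, the binary connective $\to$, and the unary modal operator $\Box$; other connectives are the usual abbreviations. $\mathsf{Fml}$ is the set of all formulas. A Kripke frame is a pair $\langle W,R\rangle$ with $W$ a non-empty set and $R\subseteq W\times W$ (not assumed transitive). A Kripke model $\langle W,R,V\rangle$ adds a valuation $V:W\times\mathsf{Fml}\to\{\mathsf{true},\mathsf{false}\}$ satisfying: $V(w,\bot)=\mathsf{false}$; $V(w,\varphi\to\psi)=\mathsf{true}$ iff $V(w,\varphi)=\mathsf{false}$ or $V(w,\psi)=\mathsf{true}$; $V(w,\Box\varphi)=\mathsf{true}$ iff $V(w',\varphi)=\mathsf{true}$ for all $w'$ with $wRw'$. A formula $\varphi$ is true at $w$ if $V(w,\varphi)=\mathsf{true}$. An $\mathcal F$-model is a Kripke model $\langle W,R,V\rangle$ with $\langle W,R\rangle\in\mathcal F$. The normal modal logic $L$ sound and complete with respect to $\mathcal F$ is the set of formulas that are true at every world of every $\mathcal F$-model. For a set $\Sigma$ of formulas, a world $w$ of a model is $\Sigma$-reflexive iff $V(w,\Box\alpha\to\alpha)=\mathsf{true}$ for every formula of the form $\Box\alpha$ in $\Sigma$. *)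

(* Defs.v *)
From mathcomp Require Import all_boot.
From mathcomp Require Import boolp classical_sets functions cardinality.

Set Implicit Arguments.
Unset Strict Implicit.
Unset Printing Implicit Defensive.

Local Open Scope classical_set_scope.

Inductive formula (P : Type) : Type :=
  | Var of P
  | Bot
  | Imp of formula P & formula P
  | Box of formula P.

Arguments Bot {P}.

Record frame : Type := Frame {
  world :> Type;
  acc : world -> world -> Prop;
  world_nonempty : inhabited world
}.

Record model (P : Type) : Type := Model {
  model_frame :> frame;
  val : model_frame -> formula P -> bool;
  val_bot : forall w, val w Bot = false;
  val_imp : forall w phi psi,
    val w (Imp phi psi) = true <-> val w phi = false \/ val w psi = true;
  val_box : forall w phi,
    val w (Box phi) = true <-> forall w', acc w w' -> val w' phi = true
}.

Definition true_at (P : Type) (M : model P) (w : M) (phi : formula P) : Prop :=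
  val w phi = true.

Definition logic_of (P : Type) (F : frame -> Prop) : set (formula P) :=
  [set phi | forall M : model P, F M -> forall w : M, true_at w phi].

Inductive mp_closure (P : Type) (X : set (formula P)) : formula P -> Prop :=
  | mp_base phi : X phi -> mp_closure X phi
  | mp_step phi psi :
      mp_closure X (Imp phi psi) -> mp_closure X phi -> mp_closure X psi.

Definition reflexive_extension (P : Type) (L : set (formula P)) :
    set (formula P) :=
  mp_closure (L `|` range (fun alpha => Imp (Box alpha) alpha)).

Definition sigma_reflexive (P : Type) (Sigma : set (formula P))
    (M : model P) (w : M) : Prop :=
  forall alpha, Sigma (Box alpha) -> true_at w (Imp (Box alpha) alpha).

(* The chain is indexed from 0 instead of from 1; only the order of the
   indices matters. *)
Definition chain_acc (W0 : frame) (w0 : W0) (x y : W0 + nat) : Prop :=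
  match x, y with
  | inl u, inl v => acc u v
  | inl _, inr _ => False
  | inr _, inl v => v = w0 \/ acc w0 v
  | inr n, inr m => (m < n)%N
  end.

Definition attach_chain (W0 : frame) (w0 : W0) : frame :=
  @Frame (W0 + nat)%type (@chain_acc W0 w0) (inhabits (inl w0)).

Definition closed_under_attaching_chains (F : frame -> Prop) : Prop :=
  forall W0 : frame, F W0 -> forall w0 : W0, F (attach_chain w0).

Definition descending_sequence (W : frame) (w : nat -> W) : Prop :=
  forall n m : nat, (m < n)%N -> acc (w n) (w m).

Definition C1 (P : Type) (F : frame -> Prop) (phi : formula P) : Prop :=
  exists Sigma : set (formula P), finite_set Sigma /\
    forall M : model P, F M -> forall w : M,
      sigma_reflexive Sigma w -> true_at w phi.

Definition C2 (P : Type) (F : frame -> Prop) (phi : formula P) : Prop :=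
  forall M : model P, F M ->
    exists Sigma : set (formula P), finite_set Sigma /\
      forall w : M, sigma_reflexive Sigma w -> true_at w phi.

Definition C3 (P : Type) (F : frame -> Prop) (phi : formula P) : Prop :=
  forall M : model P, F M -> forall w : nat -> M, descending_sequence w ->
    exists i : nat, forall j : nat, (i <= j)%N -> true_at (w j) phi.

Definition C4 (P : Type) (F : frame -> Prop) (phi : formula P) : Prop :=
  forall M : model P, F M -> forall w : nat -> M, descending_sequence w ->
    exists i : nat, true_at (w i) phi.

(* Main.v *)
Require Import Defs.
From mathcomp Require Import all_boot.
From mathcomp Require Import boolp classical_sets functions cardinality.

(** Compactness of modus ponens derivations gives [L+ <-> C1].  For [C2 -> C3],
    an instance [Box a -> a] fails at most once along a descending sequence: if
    it fails at [w m] then [a] is false there, so [Box a] is false at every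
    later [w n].  For [C4 -> C1], take [Sigma] to be the set of boxed
    subformulas of [phi]; if [phi] fails at a [Sigma]-reflexive world [w],
    attach a chain to [w] whose points copy the variables of [w].  By
    [Sigma]-reflexivity every subformula of [phi] keeps its truth value on the
    chain, so [phi] fails along the whole chain. *)

Set Implicit Arguments.
Unset Strict Implicit.
Unset Printing Implicit Defensive.

Local Open Scope classical_set_scope.

Lemma finite_set_induction (T : Type) (Q : set T -> Prop) :
  Q set0 -> (forall x A, Q A -> Q (x |` A)) ->
  forall A, finite_set A -> Q A.
Proof.
(* [T] will be a type of formulas over an arbitrary [P], which carries no equality structure; the
   alias [{classic T}] supplies a classical one. *)
move=> Q0 QU A /(@finite_seqP {classic T})[s ->].
elim: s => [|x s IHs]; first by rewrite set_nil.
suff -> : [set` x :: s] = x |` [set` s] by exact: QU.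
by apply/seteqP; split=> y /=; rewrite in_cons => /predU1P.
Qed.

Section Kripke.
Variable P : Type.
Implicit Types (phi psi alpha : formula P) (M : model P) (W : frame).
Implicit Types (Sigma : set (formula P)) (F : frame -> Prop).

Lemma true_imp M (w : M) phi psi :
  true_at w (Imp phi psi) <-> (true_at w phi -> true_at w psi).
Proof.
rewrite /true_at val_imp; split=> [[->|->//]//|].
by case: (Defs.val w phi) => [->//|_]; [right|left].
Qed.

Lemma true_box M (w : M) phi :
  true_at w (Box phi) <-> forall w', acc w w' -> true_at w' phi.
Proof. exact: val_box. Qed.

Lemma not_true_bot M (w : M) : ~ true_at w Bot.
Proof. by rewrite /true_at val_bot. Qed.

(** A [model] must value every formula by a Boolean, while the chain model is specified on variables
    only; the quantifier in the box clause is made Boolean classically. *)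
Fixpoint eval W (V : W -> P -> bool) (w : W) phi : bool :=
  match phi with
  | Var p => V w p
  | Bot => false
  | Imp psi chi => eval V w psi ==> eval V w chi
  | Box psi => `[< forall w', acc w w' -> eval V w' psi >]
  end.

Lemma eval_imp W (V : W -> P -> bool) w phi psi :
  eval V w (Imp phi psi) = true <->
  eval V w phi = false \/ eval V w psi = true.
Proof. by rewrite /=; case: eval; case: eval; split; auto; case. Qed.

Lemma eval_box W (V : W -> P -> bool) w phi :
  eval V w (Box phi) = true <-> forall w', acc w w' -> eval V w' phi = true.
Proof. by split=> /asboolP. Qed.

Definition model_of W (V : W -> P -> bool) : model P :=
  Model (fun _ => erefl) (eval_imp V) (eval_box V).

Lemma mp_closure_C1 F phi :
  reflexive_extension (@logic_of P F) phi -> C1 F phi.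
Proof.
elim=> {phi} [phi [Lphi|[alpha _ <-]]|phi psi _ [S [finS HS]] _ [S' [finS' HS']]].
- by exists set0; split; [exact: finite_set0|move=> M FM w _; exact: Lphi].
- exists [set Box alpha]; split; first exact: finite_set1.
  by move=> M _ w; apply.
- exists (S `|` S'); split; first by rewrite finite_setU.
  move=> M FM w Sw; have /true_imp : true_at w (Imp phi psi).
    by apply: HS => // a Sa; apply: Sw; left.
  by apply; apply: HS' => // a Sa; apply: Sw; right.
Qed.

(** A deduction argument by induction on [Sigma], for all [phi] at once: removing [Box alpha] from
    [Sigma] is paid for by replacing [phi] with [(Box alpha -> alpha) -> phi], and one modus ponens
    recovers [phi]. *)
Lemma C1_mp_closure F phi :
  C1 F phi -> reflexive_extension (@logic_of P F) phi.
Proof.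
case=> Sigma [finS]; move: Sigma finS phi.
apply: finite_set_induction => [phi Hphi|psi Sigma IH phi Hphi].
  by apply: mp_base; left=> M FM w; apply: Hphi.
have [[alpha psiE]|npsi] := pselect (exists alpha, psi = Box alpha).
  apply: (@mp_step _ _ (Imp (Box alpha) alpha)); last first.
    by apply: mp_base; right; exists alpha.
  apply: IH => M FM w Sw; apply/true_imp => Tw; apply: Hphi => // b [/=|/Sw//].
  by rewrite psiE => -[->].
apply: IH => M FM w Sw; apply: Hphi => // b [/= bE|/Sw//].
by case: npsi; exists b.
Qed.

Lemma descending_eventually_sigma_reflexive Sigma M (w : nat -> M) :
  finite_set Sigma -> descending_sequence w ->
  exists i, forall j, (i <= j)%N -> sigma_reflexive Sigma (w j).
Proof.
move=> finS dw; move: Sigma finS; apply: finite_set_induction.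
  by exists 0%N => j _ alpha.
move=> psi Sigma [i Hi].
suff [k Hk] : exists k, forall j, (k <= j)%N -> forall alpha,
    Box alpha = psi -> true_at (w j) (Imp (Box alpha) alpha).
  exists (maxn i k) => j; rewrite geq_max => /andP[ij kj] alpha.
  by case=> [|Sa]; [exact: Hk|exact: Hi].
have [[alpha [m [psiE]]]|none] := pselect (exists alpha m,
    psi = Box alpha /\ ~ true_at (w m) (Imp (Box alpha) alpha)).
  move=> Hm; exists m.+1 => j mj beta; rewrite psiE => -[->].
  apply/true_imp => /true_box /(_ _ (dw _ _ mj)) wm.
  by case: Hm; apply/true_imp.
(* Either [psi] is not boxed or its instance never fails along the sequence, so any index serves. *)
exists 0%N => j _ alpha psiE; apply: contrapT => Hj.
by apply: none; exists alpha, j.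
Qed.

Lemma C2_C3 F phi : C2 F phi -> C3 F phi.
Proof.
move=> H2 M FM w dw; have [Sigma [finS HS]] := H2 M FM.
have [i Hi] := descending_eventually_sigma_reflexive finS dw.
by exists i => j /Hi /HS.
Qed.

Fixpoint boxed_subformulas phi : set (formula P) :=
  match phi with
  | Imp psi chi => boxed_subformulas psi `|` boxed_subformulas chi
  | Box psi => Box psi |` boxed_subformulas psi
  | _ => set0
  end.

Lemma finite_boxed_subformulas phi : finite_set (boxed_subformulas phi).
Proof.
elim: phi => [p||phi IH psi IH'|phi IH] /=; try exact: finite_set0.
  by rewrite finite_setU.
by rewrite finite_setU; split=> //; exact: finite_set1.
Qed.

Section AttachChain.
Variables (M : model P) (w0 : M).

Definition chain_model : model P :=
  @model_of (attach_chain w0) (fun x p =>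
    match x with inl w => Defs.val w (Var p) | inr _ => Defs.val w0 (Var p) end).

(** No world of [M] sees a chain point, so [M] sits in the chain model as a generated submodel. *)
Lemma chain_model_inl phi (w : M) :
  true_at (inl w : chain_model) phi <-> true_at w phi.
Proof.
elim: phi w => [p||phi IH psi IH'|phi IH] w.
- by [].
- by split=> /not_true_bot.
- by rewrite !true_imp IH IH'.
- rewrite !true_box; split=> H.
    by move=> v wv; apply/IH; apply: H.
  by case=> // v wv; apply/IH; apply: H.
Qed.

Lemma chain_model_inr phi n :
  sigma_reflexive (boxed_subformulas phi) w0 ->
  true_at (inr n : chain_model) phi <-> true_at w0 phi.
Proof.
elim: phi n => [p||phi IH psi IH'|phi IH] n Sw.
- by [].
- by split=> /not_true_bot.
- rewrite !true_imp IH ?IH' // => a Sa; apply: Sw; first by right.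
  by left.
- have {}IH m : true_at (inr m : chain_model) phi <-> true_at w0 phi.
    by apply: IH => a Sa; apply: Sw; right.
  (* Chain points see every successor of [w0], which settles this direction without reflexivity.
     Conversely, they also see [w0] and the lower chain points, so [phi] is needed at [w0] itself:
     this is where [Box phi -> phi] enters. *)
  split=> H.
    apply/true_box => v wv; apply/chain_model_inl.
    by move/true_box: H; apply; right.
  have w0phi : true_at w0 phi.
    by move: H; apply/true_imp; apply: Sw; left.
  apply/true_box => -[v [->|wv]|m _]; [exact/chain_model_inl| |exact/IH].
  by apply/chain_model_inl; move/true_box: H; apply.
Qed.

End AttachChain.

Lemma C4_C1 F phi : closed_under_attaching_chains F -> C4 F phi -> C1 F phi.
Proof.
move=> hF H4; exists (boxed_subformulas phi).
split=> [|M FM w Sw]; first exact: finite_boxed_subformulas.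
(* The chain [inr] is descending by the very definition of [chain_acc]; truth of [phi] at one of its
   points passes back to [w]. *)
have [//|i /chain_model_inr] := H4 (chain_model w) (hF _ FM w) inr.
by apply.
Qed.

End Kripke.

Theorem theorem3p4 (P : Type) (F : frame -> Prop)
    (hF : closed_under_attaching_chains F) (phi : formula P) :
  let Lplus := reflexive_extension (@logic_of P F) in
  (Lplus phi <-> C1 F phi) /\
  (Lplus phi <-> C2 F phi) /\
  (Lplus phi <-> C3 F phi) /\
  (Lplus phi <-> C4 F phi).
Proof.
move=> Lplus.
have L1 : Lplus phi -> C1 F phi by exact: mp_closure_C1.
have C1L : C1 F phi -> Lplus phi by exact: C1_mp_closure.
have C12 : C1 F phi -> C2 F phi.
  by case=> S [finS HS] M FM; exists S; split=> // w; apply: HS.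
have C23 : C2 F phi -> C3 F phi by exact: C2_C3.
have C34 : C3 F phi -> C4 F phi.
  by move=> H3 M FM w /(H3 M FM)[i Hi]; exists i; apply: Hi.
have C41 : C4 F phi -> C1 F phi by exact: C4_C1.
by tauto.
Qed.
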